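(* For every $n\ge 1$, the lattice three-point bound is at least as strong as the two-point bound: $$\Delta_{\mathrm{lat}}(n)\le\Delta_2(n).$$
   Context: The Fourier transform on $\mathbb{R}^d$ is normalized by $\widehat f(y)=\int_{\mathbb{R}^d}f(x)e^{-2\pi i\langle x,y\rangle}\,dx$, and $B^n_\rho$ is the closed ball of radius $\rho$ about the origin in $\mathbb{R}^n$. $\Delta_2(n)$ is the linear programming bound for the $n$-dimensional sphere packing density: the infimum of $\operatorname{vol}(B^n_{r/2})f(0)$ over all continuous, integrable $f\colon\mathbb{R}^n\to\mathbb{R}$ with $\widehat f\ge 0$ everywhere, $\widehat f(0)=1$, and $f(x)\le 0$ for $|x|\ge r$. $\Delta_{\mathrm{lat}}(n)$ is the infimum of $\operatorname{vol}(B^n_{r/2})\sqrt{f(0,0)}$ over all continuous, integrable $f\colon\mathbb{R}^n\times\mathbb{R}^n\to\mathbb{R}$ with $\widehat f\ge 0$ everywhere, $\widehat f(0,0)=1$, and $f(x,y)\le 0$ for all $(x,y)\ne(0,0)$ such that each of $|x|,|y|,|x+y|,|x-y|$ lies in $\{0\}\cup[r,\infty)$. In both cases $r>0$ is arbitrary; by rescaling, the infimum does not depend on $r$. *)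

(* Defs.v *)
From HB Require Import structures.
From mathcomp Require Import all_boot all_order all_algebra.
From mathcomp Require Import all_classical all_reals all_analysis.
From mathcomp Require Import complex.

Set Implicit Arguments.
Unset Strict Implicit.
Unset Printing Implicit Defensive.

Import Order.TTheory GRing.Theory Num.Theory.
Import numFieldNormedType.Exports.

Local Open Scope classical_set_scope.
Local Open Scope ring_scope.

(* The library's norm on 'rV[R]_n is the sup norm: it gives the right topology
   but not the right balls, hence [enorm]. *)
Definition dot (R : realType) (n : nat) (x y : 'rV[R]_n) : R :=
  \sum_(i < n) x ord0 i * y ord0 i.

Definition enorm (R : realType) (n : nat) (x : 'rV[R]_n) : R :=
  Num.sqrt (dot x x).

Definition rV_display : measure_display. Proof. exact: default_measure_display. Qed.

(* The Borel sigma-algebra of R^n, generated by the coordinate maps (compare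
   the library's instance on tuples). *)
Section measurable_rV.
Variables (R : realType) (n : nat).

Definition rV_coord (i : 'I_n) (x : 'rV[R]_n) : measurableTypeR R := x ord0 i.

Let rV_set0 : g_sigma_preimage rV_coord set0.
Proof. exact: sigma_algebra0. Qed.

Let rV_setC A : g_sigma_preimage rV_coord A -> g_sigma_preimage rV_coord (~` A).
Proof. exact: sigma_algebraC. Qed.

Let rV_bigcup (F : _^nat) : (forall i, g_sigma_preimage rV_coord (F i)) ->
  g_sigma_preimage rV_coord (\bigcup_i (F i)).
Proof. exact: sigma_algebra_bigcup. Qed.

HB.instance Definition _ := @isMeasurable.Build rV_display
  'rV[R]_n (g_sigma_preimage rV_coord) rV_set0 rV_setC rV_bigcup.

Lemma measurable_rV_coord (i : 'I_n) : measurable_fun setT (rV_coord i).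
Proof.
move=> _ Y mY; rewrite setTI; apply: sub_sigma_algebra => /=.
rewrite -bigcup_seq/=; exists i => /=; first by rewrite mem_index_enum.
by exists Y => //; rewrite setTI.
Qed.

Lemma measurable_fun_rVP d (T : measurableType d) (f : T -> 'rV[R]_n) :
  measurable_fun setT f <-> forall i, measurable_fun setT (rV_coord i \o f).
Proof.
split=> [mf i|mf]; first exact: measurableT_comp (measurable_rV_coord i) mf.
have -> : measurable_fun setT f <->
    g_sigma_preimage (fun i => rV_coord i \o f) `<=` measurable.
  rewrite g_sigma_preimage_comp; split=> [{}mf A [/= C preC <-]|prefS].
    exact: mf.
  by move=> _ A mA; apply: prefS; exists A.
apply: smallest_sub; first exact: sigma_algebra_measurable.
rewrite -bigcup_seq => A [i _ [B mB <-]]; exact: mf.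
Qed.

End measurable_rV.

Definition cons_rV (R : realType) (n : nat)
    (p : measurableTypeR R * 'rV[R]_n) : 'rV[R]_n.+1 :=
  \row_i oapp (p.2 ord0) p.1 (unlift ord0 i).

Lemma measurable_cons_rV (R : realType) (n : nat) :
  measurable_fun setT (@cons_rV R n).
Proof.
apply/measurable_fun_rVP => i; case: (unliftP ord0 i) => [j|] ->.
- rewrite (_ : _ \o _ = rV_coord j \o snd).
    exact: measurableT_comp (measurable_rV_coord j) measurable_snd.
  by apply/funext => p; rewrite /= /rV_coord mxE liftK.
- rewrite (_ : _ \o _ = fst); first exact: measurable_fst.
  by apply/funext => p; rewrite /= /rV_coord mxE unlift_none.
Qed.

Definition uncons_rV (R : realType) (n : nat) (x : 'rV[R]_n.+1) :
    measurableTypeR R * 'rV[R]_n :=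
  (x ord0 ord0, \row_j x ord0 (lift ord0 j)).

Lemma cons_rVK (R : realType) (n : nat) :
  cancel (@cons_rV R n) (@uncons_rV R n).
Proof.
move=> [a x]; rewrite /uncons_rV mxE unlift_none /=; congr pair.
by apply/rowP => j; rewrite !mxE liftK.
Qed.

Lemma measurable_uncons_rV (R : realType) (n : nat) :
  measurable_fun setT (@uncons_rV R n).
Proof.
apply: measurable_fun_pair; first exact: (measurable_rV_coord ord0).
apply/measurable_fun_rVP => i.
rewrite (_ : _ \o _ = rV_coord (lift ord0 i)); first exact: measurable_rV_coord.
by apply/funext => x; rewrite /= /rV_coord mxE.
Qed.

(* The sigma-finiteness instance of the library on [_ \x _] is shadowed by the
   one on subprobabilities. *)
Lemma sigma_finite_product d1 d2 (T1 : measurableType d1)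
    (T2 : measurableType d2) (R : realType)
    (m1 : {sigma_finite_measure set T1 -> \bar R})
    (m2 : {sigma_finite_measure set T2 -> \bar R}) :
  sigma_finite setT (m1 \x m2)%E.
Proof.
have /sigma_finiteP[F [TF ndF Foo]] := sigma_finiteT m1.
have /sigma_finiteP[G [TG ndG Goo]] := sigma_finiteT m2.
exists (fun n => F n `*` G n).
  rewrite -setXTT TF TG predeqE => -[x y]; split.
    move=> [/= [n _ Fnx] [k _ Gky]]; exists (maxn n k) => //; split.
    - by move: x Fnx; exact/subsetPset/ndF/leq_maxl.
    - by move: y Gky; exact/subsetPset/ndG/leq_maxr.
  by move=> [n _ []/= ? ?]; split; exists n.
move=> k; have [? ?] := Foo k; have [? ?] := Goo k.
split; first exact: measurableX.
by rewrite product_measure1E// lte_mul_pinfty// ge0_fin_numE.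
Qed.

Section lebesgue_cons.
Local Open Scope ereal_scope.
Variables (R : realType) (n : nat).
Variable m : {sigma_finite_measure set 'rV[R]_n -> \bar R}.

Let leb : {sigma_finite_measure set (measurableTypeR R) -> \bar R} :=
  @lebesgue_measure R.

Definition lebesgue_cons : set 'rV[R]_n.+1 -> \bar R :=
  pushforward (leb \x m) (@cons_rV R n).

Let mcons := @measurable_cons_rV R n.

Let lebesgue_cons0 : lebesgue_cons set0 = 0.
Proof. exact: measure0. Qed.

Let lebesgue_cons_ge0 A : 0 <= lebesgue_cons A.
Proof. exact: measure_ge0. Qed.

Let lebesgue_cons_sigma_additive : semi_sigma_additive lebesgue_cons.
Proof. exact: (@measure_semi_sigma_additive _ _ _ (pushforward _ _)). Qed.

HB.instance Definition _ := isMeasure.Build _ _ _ lebesgue_cons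
  lebesgue_cons0 lebesgue_cons_ge0 lebesgue_cons_sigma_additive.

Let lebesgue_cons_sigma_finite : sigma_finite setT lebesgue_cons.
Proof.
have [F FT Foo] := sigma_finite_product leb m.
exists (fun k => @uncons_rV R n @^-1` F k).
  by rewrite -preimage_bigcup -FT preimage_setT.
move=> k; have [mF Fk] := Foo k; split.
  by rewrite -[X in measurable X]setTI; exact: measurable_uncons_rV.
rewrite /lebesgue_cons /pushforward -comp_preimage.
by rewrite (_ : _ \o _ = id) //; apply/funext => p /=; rewrite cons_rVK.
Qed.

HB.instance Definition _ := Measure_isSigmaFinite.Build _ _ _ lebesgue_cons
  lebesgue_cons_sigma_finite.

End lebesgue_cons.

(* Lebesgue measure on R^n, as the iterated product of the Lebesgue measure
   on R; see [lebesgue_rV_box]. *)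
Fixpoint lebesgue_rV (R : realType) (n : nat) :
    {sigma_finite_measure set 'rV[R]_n -> \bar R} :=
  if n is n'.+1 then lebesgue_cons (lebesgue_rV R n')
  else dirac (0 : 'rV[R]_0).

Lemma lebesgue_rV_box (R : realType) (n : nat)
    (A : 'I_n -> set (measurableTypeR R)) : (forall i, measurable (A i)) ->
  lebesgue_rV R n [set x | forall i, A i (x ord0 i)] =
  (\prod_(i < n) lebesgue_measure (A i))%E.
Proof.
elim: n A => [|n IHn] A mA.
  rewrite big_ord0 /= diracE mem_set //; by case.
rewrite big_ord_recl -(IHn (fun i => A (lift ord0 i))) //.
set B := [set x : 'rV[R]_n | forall i, A (lift ord0 i) (x ord0 i)].
transitivity ((lebesgue_measure \x lebesgue_rV R n)%E (A ord0 `*` B)).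
  rewrite /= /lebesgue_cons /pushforward; congr product_measure1.
  apply/seteqP; split=> -[a x] /=.
    move=> Aax; split; first by have := Aax ord0; rewrite mxE unlift_none.
    by move=> i; have := Aax (lift ord0 i); rewrite mxE liftK.
  move=> [Aa Ax] i; rewrite mxE.
  by case: (unliftP ord0 i) => [j|] ->; [exact: Ax|].
apply: product_measure1E => //.
rewrite (_ : B = \bigcap_(i in [set: 'I_n]) (rV_coord i @^-1` A (lift ord0 i))).
  apply: fin_bigcap_measurable => [|i _]; first exact: finite_finset.
   rewrite -[X in measurable X]setTI.
  exact: measurable_rV_coord.
by apply/seteqP; split=> x Bx i; [move=> _|]; exact: (Bx i).
Qed.

Definition lebesgue_rV2 (R : realType) (n : nat) :
    {measure set ('rV[R]_n * 'rV[R]_n)%type -> \bar R} :=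
  (lebesgue_rV R n \x lebesgue_rV R n)%E.

Definition dot2 (R : realType) (n : nat) (p q : 'rV[R]_n * 'rV[R]_n) : R :=
  dot p.1 q.1 + dot p.2 q.2.

Section fourier.
Local Open Scope complex_scope.

Definition expi (R : realType) (t : R) : R[i] := cos t +i* sin t.

Definition Cintegral d (T : measurableType d) (R : realType)
    (mu : {measure set T -> \bar R}) (g : T -> R[i]) : R[i] :=
  (\int[mu]_x complex.Re (g x)) +i* (\int[mu]_x complex.Im (g x)).

Definition fourier d (T : measurableType d) (R : realType)
    (mu : {measure set T -> \bar R}) (ip : T -> T -> R) (f : T -> R) (y : T) :
    R[i] :=
  Cintegral mu (fun x => (f x)%:C * expi (- (2 * pi * ip x y))).

End fourier.

Definition ball_vol (R : realType) (n : nat) (rho : R) : \bar R :=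
  lebesgue_rV R n [set x | enorm x <= rho].

(* In both definitions [0 <=] is the order of [R[i]]: it says that the Fourier
   transform is real and nonnegative. *)
Definition LP2_feasible (R : realType) (n : nat) (r : R)
    (f : 'rV[R]_n -> R) : Prop :=
  let fhat := fourier (lebesgue_rV R n) (@dot R n) f in
  [/\ continuous f,
      (lebesgue_rV R n).-integrable setT (EFin \o f),
      (forall y, 0 <= fhat y),
      fhat 0 = 1 &
      forall x, r <= enorm x -> f x <= 0].

Definition LPlat_feasible (R : realType) (n : nat) (r : R)
    (f : 'rV[R]_n * 'rV[R]_n -> R) : Prop :=
  let fhat := fourier (lebesgue_rV2 R n) (@dot2 R n) f in
  let ok (x : 'rV[R]_n) := enorm x = 0 \/ r <= enorm x in
  [/\ continuous f,
      (lebesgue_rV2 R n).-integrable setT (EFin \o f),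
      (forall p, 0 <= fhat p),
      fhat (0, 0) = 1 &
      forall x y, (x, y) <> (0, 0) ->
        ok x -> ok y -> ok (x + y) -> ok (x - y) -> f (x, y) <= 0].

(* The infima are taken in the extended reals, where that of the empty set
   is +oo; by rescaling they do not depend on [r] > 0. *)
Definition Delta2 (R : realType) (n : nat) (r : R) : \bar R :=
  ereal_inf [set (ball_vol n (r / 2) * (f 0)%:E)%E
            | f in LP2_feasible (n := n) r].

Definition Delta_lat (R : realType) (n : nat) (r : R) : \bar R :=
  ereal_inf [set (ball_vol n (r / 2) * (Num.sqrt (f (0, 0)))%:E)%E
            | f in LPlat_feasible (n := n) r].

(* Main.v *)
Require Import Defs.
From mathcomp Require Import all_boot all_order all_algebra.
From mathcomp Require Import all_classical all_reals all_analysis.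
From mathcomp Require Import measurable_realfun complex.
From mathcomp Require Import zify ring lra.

(* Given [f] feasible for the two-point bound and [0 < c < 1], put
     F(x, y) = f(0) (f(x) - w(x)) k(y) + w(x) f(y),
   where [k] is a positive definite cutoff with [k(0) = 1] vanishing for
   [|y| >= r], and [w >= 0] satisfies [0 <= hat w <= hat f], [hat w(0) = c].
   Then [F(0, 0) = f(0)^2], [F(x, 0) = f(0) f(x) <= 0] for [|x| >= r] since the
   terms in [w] cancel, and [F(x, y) = w(x) f(y) <= 0] for [|y| >= r].  Moreover
   [hat F = f(0) (hat f - hat w) hat k + hat w hat f >= 0] and
   [hat F(0, 0) >= c], so [F / hat F(0, 0)] is feasible with value at most
   [f(0)^2 / c] at the origin; let [c] tend to [1].
   As [hat f] may vanish away from [0], [hat w] must have small support: [w] is a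
   multiple of a product of Fejer kernels, whose transform is a product of tents,
   and [k] is itself a product of tents. *)

Set Implicit Arguments.
Unset Strict Implicit.
Unset Printing Implicit Defensive.

Import Order.TTheory GRing.Theory Num.Theory.
Import numFieldNormedType.Exports.
Local Open Scope classical_set_scope.
Local Open Scope ring_scope.

(** * The Fejer kernel and the tent function on the line *)

Section sinc.
Context {R : realType}.
Notation leb := (@lebesgue_measure R).
Implicit Types (x y t a b : R).

Lemma sin_le_norm x : `|sin x| <= `|x|.
Proof.
wlog x0 : x / 0 < x.
  move=> H; have [x0|x0|->] := ltgtP x 0; last by rewrite sin0 normr0.
    by rewrite -normrN -sinN -(normrN x) H// oppr_gt0.
  exact: H.
have [c _ ] : exists2 c, c \in `]0, x[ & sin x - sin 0 = cos c * (x - 0).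
  apply: MVT => //.
  by apply: continuous_subspaceT => z; exact: continuous_sin.
rewrite sin0 !subr0 => ->; rewrite normrM ler_piMl//.
exact: cos_max.
Qed.

(** The value 1 at 0 removes the singularity, so that kernels built from [sinc] are continuous on
    the whole line. *)
Definition sinc x := if x == 0 then 1 else sin x / x.

Lemma sincE x : x * sinc x = sin x.
Proof.
rewrite /sinc; case: eqVneq => [->|x0]; first by rewrite mul0r sin0.
by rewrite mulrC divfK.
Qed.

Lemma sincN x : sinc (- x) = sinc x.
Proof. by rewrite /sinc oppr_eq0 sinN invrN mulrNN. Qed.

Lemma sinc_norm_le1 x : `|sinc x| <= 1.
Proof.
rewrite /sinc; case: eqVneq => [_|x0]; first by rewrite normr1.
by rewrite normrM normfV ler_pdivrMr ?normr_gt0// mul1r sin_le_norm.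
Qed.

(** Away from 0 this is a quotient of continuous functions. At 0, [sin x / x] is the difference
    quotient of the sine, whose limit is [cos 0 = 1]. *)
Lemma continuous_sinc : continuous sinc.
Proof.
move=> x; have [->|x0] := eqVneq x 0; last first.
  have : {near x, (fun y => sin y / y) =1 sinc}.
    near=> y; rewrite /sinc ifF//; apply/negbTE; near: y.
    exact: (cvgr_neq0 _ cvg_id x0).
  move=> H; rewrite /continuous_at {2}/sinc (negbTE x0).
  apply: cvg_trans; first by apply: near_eq_cvg; exact: H.
  by apply: cvgM; [exact: continuous_sin|exact: cvgV].
apply/cvgrPdist_lt => e e0.
have : derivable (@sin R) 0 1 by exact: derivable_sin.
move=> /cvg_ex[l cl].
have ld : 'D_1 (@sin R) 0 = l by exact: (cvg_lim _ cl).
have l1 : l = 1 by rewrite -ld derive_val cos0.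
move: cl; rewrite l1 => /cvgrPdist_lt /(_ _ e0).
rewrite near_withinE => /nbhs_ballP[d /= d0 H].
apply/nbhs_ballP; exists d => //= y yd.
rewrite {1}/sinc eqxx /sinc; case: eqVneq => [_|y0]; first by rewrite subrr normr0.
have := H y yd y0.
by rewrite addr0 sin0 subr0 /GRing.scale/= mulr1 (mulrC _ (sin y)).
Unshelve. all: by end_near. Qed.


End sinc.

(** * Invariance of Lebesgue integrals under reflection *)

Section reflection.
Context {R : realType}.
Notation leb := (@lebesgue_measure R).

Let opp : measurableTypeR R -> measurableTypeR R := fun x : R => - x.

(** Reflection sends []a, b]] to [[-b, -a[], of the same length. Agreement on half-open intervals
    suffices, since they determine Lebesgue measure. *)
Let ocitv_leb_opp (X : set R) : ocitv X ->
  leb X = pushforward leb opp X.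
Proof.
move=> /ocitvP[->|[[a b] /= ab ->]]; first by rewrite /pushforward preimage_set0 !measure0.
rewrite /pushforward.
rewrite (_ : _ @^-1` _ = `[- b, - a[%classic); last first.
  by apply/funext => z; rewrite /opp /= !in_itv /= ltrNr lerNl andbC.
rewrite !lebesgue_measure_itv/= !lte_fin ltrN2.
by case: ifPn => // _; rewrite -!EFinB opprK addrC.
Qed.

Let mopp : measurable_fun setT opp.
Proof. by apply: continuous_measurable_fun; exact: opp_continuous. Qed.

Let integral_leb_opp (f : R -> \bar R) :
  (\int[pushforward leb opp]_x f x = \int[leb]_x f x)%E.
Proof.
apply: eq_measure_integral => A mA _; apply/esym.
exact: (@lebesgue_measure_unique R (pushforward leb _) ocitv_leb_opp).
Qed.

Let integrable_opp (f : R -> R) : leb.-integrable setT (EFin \o f) ->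
  leb.-integrable setT ((EFin \o f) \o opp).
Proof.
move=> /integrableP[mf foo]; apply/integrableP; split.
  exact: measurableT_comp mf mopp.
rewrite -integral_leb_opp ge0_integral_pushforward// in foo.
exact: measurableT_comp mf.
Qed.

Lemma Rintegral_opp (f : R -> R) : leb.-integrable setT (EFin \o f) ->
  \int[leb]_x f (- x) = \int[leb]_x f x.
Proof.
move=> fi; congr fine.
rewrite -[RHS]integral_leb_opp integral_pushforward//.
  exact: (measurable_int _ fi).
exact: integrable_opp.
Qed.

End reflection.

(** * Fejer kernels before normalisation, and their integrals *)

Section fejer.
Context {R : realType}.
Notation leb := (@lebesgue_measure R).
Implicit Types (x y t a b : R).

(** This is [(sin (t x) / x)^2], extended by its limit [t^2] at [x = 0]. *)
Definition fejer_num t x := t ^+ 2 * sinc (t * x) ^+ 2.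

Lemma fejer_num_ge0 t x : 0 <= fejer_num t x.
Proof. by rewrite mulr_ge0// sqr_ge0. Qed.

Lemma fejer_numN t x : fejer_num t (- x) = fejer_num t x.
Proof. by rewrite /fejer_num mulrN sincN. Qed.

Lemma continuous_fejer_num t : continuous (fejer_num t).
Proof.
move=> x; apply: cvgM; first exact: cvg_cst.
have c : sinc (t * y) @[y --> x] --> sinc (t * x).
  by apply: continuous_comp; [exact: mulrl_continuous|exact: continuous_sinc].
by rewrite /continuous_at expr2; under eq_fun do rewrite expr2; exact: cvgM.
Qed.

Lemma fejer_numE t x : x ^+ 2 * fejer_num t x = sin (t * x) ^+ 2.
Proof. by rewrite /fejer_num -sincE; ring. Qed.

(** Sum of two bounds: the kernel is at most [t^2] because [|sinc| <= 1], and [x^2] times the kernel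
    is [sin^2 (t x) <= 1]. The right-hand side is an integrable majorant. *)
Lemma fejer_num_le t x : fejer_num t x <= (t ^+ 2 + 1) * (oneDsqr x)^-1.
Proof.
rewrite ler_pdivlMr ?oneDsqr_gt0// /oneDsqr mulrDr mulr1 lerD//.
  rewrite /fejer_num ler_piMr ?sqr_ge0// -real_normK ?num_real//.
  by rewrite expr_le1// sinc_norm_le1.
rewrite mulrC fejer_numE -real_normK ?num_real// expr_le1//.
exact: sin_max.
Qed.

Lemma integrable_oneDsqrV : leb.-integrable setT (EFin \o (fun x => (oneDsqr x)^-1)).
Proof.
have c : continuous (fun x : R => (oneDsqr x)^-1) by exact: continuous_oneDsqrV.
apply/integrableP; split.
  by apply/measurable_EFinP; exact: continuous_measurable_fun.
under eq_integral do rewrite /= ger0_norm ?invr_ge0 ?oneDsqr_ge0//.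
rewrite ge0_symfun_integralT//.
- rewrite -set_itvcy integral0y_oneDsqr -EFinM; exact: ltry.
- by move=> x /=; rewrite /oneDsqr sqrrN.
Qed.

Lemma integrable_fejer_num t : leb.-integrable setT (EFin \o fejer_num t).
Proof.
have /= := integrableZl measurableT (t ^+ 2 + 1) integrable_oneDsqrV.
apply: le_integrable => //.
- apply/measurable_EFinP; apply: continuous_measurable_fun.
  exact: continuous_fejer_num.
- move=> x _ /=; rewrite lee_fin ger0_norm ?fejer_num_ge0//.
  rewrite ger0_norm ?fejer_num_le//.
  by rewrite mulr_ge0 ?invr_ge0 ?oneDsqr_ge0// addr_ge0// sqr_ge0.
Qed.

(* Only [0 < fejer_mass] matters: its value cancels in the normalised kernel
   [fejer]. *)
Definition fejer_mass := \int[leb]_x fejer_num 1 x.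

(** By continuity [g] exceeds [g 0 / 2] on some ball about 0, so its integral is at least [g 0 / 2]
    times the positive measure of that ball. *)
Lemma Rintegral_continuous_gt0 (g : R -> R) : continuous g -> (forall x, 0 <= g x) ->
  leb.-integrable setT (EFin \o g) -> 0 < g 0 -> 0 < \int[leb]_x g x.
Proof.
move=> cg g0 ig gp; pose e := g 0 / 2.
have e0 : 0 < e by rewrite divr_gt0.
have /cvgrPdist_lt /(_ e e0) /nbhs_ballP[d /= d0 H] := cg 0.
have mb : measurable (ball (0:R) d) by exact: measurable_ball.
have : e * fine (leb (ball (0:R) d)) <= \int[leb]_x g x.
  rewrite -Rintegral_cst// Rintegral_mkcond; apply: le_Rintegral => //.
  - rewrite -restrict_EFin; apply/integrable_restrict => //; rewrite setTI.
    apply/integrableP; split; first exact: measurable_cst.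
    rewrite integral_cst//= lebesgue_measure_ball ?ltW// -EFinM; exact: ltry.
  - move=> x _; rewrite patchE; case: ifPn => [|_]; last exact: g0.
    by rewrite inE => /H; rewrite ltr_distl /e => /andP[]; lra.
apply: lt_le_trans; rewrite lebesgue_measure_ball ?ltW//=.
by rewrite mulr_gt0// mulrn_wgt0.
Qed.

Lemma fejer_mass_gt0 : 0 < fejer_mass.
Proof.
apply: Rintegral_continuous_gt0.
- exact: continuous_fejer_num.
- exact: fejer_num_ge0.
- exact: integrable_fejer_num.
- by rewrite /fejer_num mulr0 /sinc eqxx !expr1n mulr1.
Qed.

(** The kernel is even in [t] and vanishes for [t = 0]; for [t > 0] the scaling [x -> t x] reduces
    the integral to the case [t = 1]. *)
Lemma Rintegral_fejer_num t : \int[leb]_x fejer_num t x = `|t| * fejer_mass.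
Proof.
wlog t0 : t / 0 < t.
  move=> H; have [t0|t0|->] := ltgtP t 0; [|exact: H|].
    rewrite -normrN -H ?oppr_gt0//; apply: eq_Rintegral => x _.
    by rewrite /fejer_num sqrrN mulNr sincN.
  rewrite normr0 mul0r /Rintegral integral0_eq// => x _.
  by rewrite /fejer_num expr0n/= mul0r.
rewrite gtr0_norm// /fejer_mass.
have dF x : is_derive x 1 ( *%R t) t.
  rewrite (_ : *%R t = t *: id); last by apply/funext => y.
  by apply: is_derive_eq; rewrite /GRing.scale/= mulr1.
have dE : derive1 ( *%R t) = cst t.
  by apply/funext => x; rewrite derive1E derive_val.
rewrite {2}/Rintegral (@increasing_ge0_integration_by_substitutionT _ ( *%R t)
  (fejer_num 1)).
- rewrite dE -/(Rintegral _ _ _).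
  (* The substituted integrand [fejer_num 1 (t x) * t] equals [t^-1 * fejer_num t x]. *)
  transitivity (t * \int[leb]_x (t^-1 * fejer_num t x)).
    rewrite (RintegralZl _ measurableT (integrable_fejer_num t)).
    by rewrite mulrA divff ?gt_eqF ?mul1r.
  congr (_ * _); apply: eq_Rintegral => x _.
  rewrite /fejer_num /= mul1r expr1n mul1r expr2 !mulrA mulVf ?gt_eqF//.
  by rewrite mul1r -mulrA -expr2 mulrC.
- by move=> x y xy; rewrite ltr_pM2l.
- by rewrite dE; exact: cst_continuous.
- rewrite dE; exact: is_cvg_cst.
- rewrite dE; exact: is_cvg_cst.
- by move=> x.
- exact: (gt0_cvgMrNy t0 cvg_id).
- exact: (gt0_cvgMry t0 cvg_id).
- exact: continuous_fejer_num.
- exact: fejer_num_ge0.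
Qed.


(** Multiplied by [x^2], this is a trigonometric identity for [sin^2 (b x) cos (2 u x)]; at [x = 0]
    both sides are [b^2]. A modulated kernel thus becomes a combination of unmodulated ones, whose
    integrals follow from scaling alone, without any inversion theorem. *)
Lemma fejer_num_cos b u x : fejer_num b x * cos (2 * u * x) =
  2^-1 * (fejer_num (b + u) x + fejer_num (b - u) x - 2 * fejer_num u x).
Proof.
have [->|x0] := eqVneq x 0.
  by rewrite /fejer_num !mulr0 cos0 /sinc eqxx; field.
apply: (@mulfI _ (x ^+ 2)); first by rewrite expf_eq0.
rewrite mulrA; transitivity (2^-1 * (x ^+ 2 * fejer_num (b + u) x +
    x ^+ 2 * fejer_num (b - u) x - 2 * (x ^+ 2 * fejer_num u x))); last by ring.
rewrite !fejer_numE.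
rewrite (_ : 2 * u * x = (u * x) *+ 2); last by rewrite -mulrA mulr_natl.
rewrite mulrDl mulrBl sinD sinB cos_mulr2n.
set s := sin (b * x); set c := cos (b * x).
set S := sin (u * x); set C := cos (u * x).
have hc : c ^+ 2 = 1 - s ^+ 2 by exact: cos2sin2.
have hC : C ^+ 2 = 1 - S ^+ 2 by exact: cos2sin2.
transitivity (2^-1 * (2 * s ^+ 2 * C ^+ 2 + 2 * c ^+ 2 * S ^+ 2 - 2 * S ^+ 2)); last by ring.
by rewrite hc hC; field.
Qed.

(** * The normalised Fejer kernel and its transform, the tent *)

Definition tent b y := Num.max 0 (1 - `|y| / b).

(** The parameter [b] is the half-width of the support of the transform. The denominator is the
    integral of the numerator when [b > 0], which makes the transform equal to 1 at frequency 0. *)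
Definition fejer b x := fejer_num (pi * b) x / (fejer_mass * (pi * b)).

Lemma fejer_ge0 b x : 0 < b -> 0 <= fejer b x.
Proof.
move=> b0; rewrite divr_ge0 ?fejer_num_ge0// !mulr_ge0// ?pi_ge0 ?ltW//.
exact: fejer_mass_gt0.
Qed.

Lemma fejerN b x : fejer b (- x) = fejer b x.
Proof. by rewrite /fejer fejer_numN. Qed.

Lemma continuous_fejer b : continuous (fejer b).
Proof.
move=> x; apply: cvgM; last exact: cvg_cst.
exact: continuous_fejer_num.
Qed.

Lemma integrable_fejer b : leb.-integrable setT (EFin \o fejer b).
Proof.
have := integrableZr measurableT (fejer_mass * (pi * b))^-1 (integrable_fejer_num (pi * b)).
by apply: eq_integrable.
Qed.

(** A second difference of the absolute value is a tent; this is the combination of masses that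
    integrating [fejer_num_cos] produces. It is checked on each choice of signs. *)
Lemma tentE b y : 0 < b ->
  (`|b + y| + `|b - y| - 2 * `|y|) / (2 * b) = tent b y.
Proof.
move=> b0; have bn0 : b != 0 by rewrite gt_eqF.
rewrite /tent; apply: (@mulIf _ (2 * b)); first by rewrite mulf_neq0.
rewrite divfK ?mulf_neq0// maxr_pMl ?mulr_ge0 ?ltW//.
rewrite mul0r mulrBl mul1r [`|y| / b * _]mulrCA divfK//.
have [h1|h1] := ger0P (b + y); have [h2|h2] := ger0P (b - y);
  have [h3|h3] := ger0P y; case: leP => h4; lra.
Qed.

(** By [fejer_num_cos] with [u = pi y], the integral is a combination of masses proportional to
    [|b + y|], [|b - y|] and [|y|]. The common factor [fejer_mass] cancels and [tentE] identifies
    the result. *)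
Lemma Rintegral_fejer_cos b y : 0 < b ->
  \int[leb]_x (fejer b x * cos (- (2 * pi * (x * y)))) = tent b y.
Proof.
move=> b0.
have J0 : fejer_mass != 0 :> R by rewrite gt_eqF ?fejer_mass_gt0.
have p0 : pi != 0 :> R by rewrite gt_eqF ?pi_gt0.
have bn0 : b != 0 by rewrite gt_eqF.
pose u := pi * y.
pose c := 2^-1 / (fejer_mass * (pi * b)).
transitivity (\int[leb]_x (c * (fejer_num (pi * b + u) x + fejer_num (pi * b - u) x
    - 2 * fejer_num u x))).
  apply: eq_Rintegral => x _.
  rewrite /fejer cosN mulrAC (_ : 2 * pi * (x * y) = 2 * u * x); last by rewrite /u; ring.
  by rewrite fejer_num_cos /c mulrAC.
have i1 := integrable_fejer_num (pi * b + u).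
have i2 := integrable_fejer_num (pi * b - u).
have i3 := integrable_fejer_num u.
have i3' : leb.-integrable setT (EFin \o (fun x => 2 * fejer_num u x)).
  exact: integrableZl i3.
have i12 : leb.-integrable setT
    (EFin \o (fun x => fejer_num (pi * b + u) x + fejer_num (pi * b - u) x)).
  exact: integrableD i1 i2.
rewrite RintegralZl//; last exact: integrableB i12 i3'.
rewrite RintegralB// RintegralD// RintegralZl// !Rintegral_fejer_num /c.
rewrite /u -mulrDr -mulrBr !normrM (gtr0_norm (pi_gt0 R)).
transitivity ((`|b + y| + `|b - y| - 2 * `|y|) / (2 * b)).
  move: fejer_mass pi J0 p0 {c i1 i2 i3 i3' i12} => J p J0 p0.
  by field; rewrite bn0 p0.

exact: tentE.
Qed.


(** * Bounds and integrability of the tent, and the sign of its transform *)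

Lemma tent_ge0 b y : 0 <= tent b y.
Proof. by rewrite /tent le_max lexx. Qed.

Lemma tent_le1 b y : 0 < b -> tent b y <= 1.
Proof. by move=> b0; rewrite /tent ge_max ler01 gerBl divr_ge0// ltW. Qed.

Lemma tent0 b : tent b 0 = 1.
Proof. by rewrite /tent normr0 mul0r subr0 max_r. Qed.

Lemma tentN b y : tent b (- y) = tent b y.
Proof. by rewrite /tent normrN. Qed.

Lemma tent_eq0 b y : 0 < b -> b <= `|y| -> tent b y = 0.
Proof. by move=> b0 yb; rewrite /tent max_l// subr_le0 ler_pdivlMr// mul1r. Qed.

Lemma continuous_tent b : continuous (tent b).
Proof.
move=> x; apply: (@continuous_max _ _ (cst 0) (fun y => 1 - `|y| / b)).
  exact: cst_continuous.
apply: cvgB; first exact: cvg_cst.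
by apply: cvgM; [exact: norm_continuous|exact: cvg_cst].
Qed.

Lemma integrable_tent b : 0 < b -> leb.-integrable setT (EFin \o tent b).
Proof.
move=> b0.
rewrite (_ : tent b = tent b \_ `[- b, b]); last first.
  apply/funext => x; rewrite patchE; case: ifPn => // /negP.
  rewrite inE/= in_itv/= -ler_norml => /negP; rewrite -ltNge => /ltW.
  exact: tent_eq0.
rewrite -restrict_EFin; apply/integrable_restrict => //; rewrite setTI.
apply: continuous_compact_integrable; first exact: segment_compact.
by apply: continuous_subspaceT; exact: continuous_tent.
Qed.

(** Integration by parts gives the antiderivative [F]. The lemma is applied to the two linear halves
    of the tent, with [k = 1/b] and [k = -1/b]. *)
Lemma Rintegral_linear_cos (k w c d : R) : w != 0 -> c < d ->
  \int[leb]_(x in `[c, d]) ((1 - k * x) * cos (w * x)) =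
  ((1 - k * d) * sin (w * d) / w - k * cos (w * d) / w ^+ 2) -
  ((1 - k * c) * sin (w * c) / w - k * cos (w * c) / w ^+ 2).
Proof.
move=> w0 cd.
pose F (x : R) : R := (1 - k * x) * sin (w * x) / w - k * cos (w * x) / w ^+ 2.
have dF x : is_derive x 1 F ((1 - k * x) * cos (w * x)).
  apply: is_derive_eq.
  rewrite /GRing.scale /= !mulr1 ?mulr0 ?add0r ?addr0 ?sub0r; field.
  by [].
have cF : continuous F.
  by move=> x; apply: differentiable_continuous; apply/derivable1_diffP.
have ccos (z : R) : {for z, continuous (fun x : R => (1 - k * x) * cos (w * x))}.
  apply: cvgM.
    by apply: cvgB; [exact: cvg_cst|apply: cvgM; [exact: cvg_cst|exact: cvg_id]].
  by apply: continuous_comp; [exact: mulrl_continuous|exact: continuous_cos].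
rewrite /Rintegral (@continuous_FTC2 _ _ F)//.
- by apply: continuous_subspaceT.
- split; first by move=> x _.
  + by apply: cvg_at_right_filter; exact: cF.
  + by apply: cvg_at_left_filter; exact: cF.
- by move=> x _; rewrite derive1E derive_val.
Qed.

(** For [w = 2 pi y] nonzero the integral is computed explicitly as [2 (1 - cos (w b)) / (b w^2)],
    which is visibly nonnegative; for [y = 0] the integrand is the tent itself. *)
Lemma Rintegral_tent_cos_ge0 b y : 0 < b ->
  0 <= \int[leb]_x (tent b x * cos (- (2 * pi * (x * y)))).
Proof.
move=> b0; have [->|y0] := eqVneq y 0.
  by apply: Rintegral_ge0 => x _; rewrite !mulr0 oppr0 cos0 mulr1 tent_ge0.
pose w := 2 * pi * y.
have w0 : w != 0 by rewrite !mulf_neq0// gt_eqF// pi_gt0.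
pose h x := tent b x * cos (w * x).
have ch : continuous h.
  move=> x; apply: cvgM; first exact: continuous_tent.
  by apply: continuous_comp; [exact: mulrl_continuous|exact: continuous_cos].
have hi : leb.-integrable `[- b, b] (EFin \o h).
  apply: continuous_compact_integrable; first exact: segment_compact.
  exact: continuous_subspaceT.
have -> : \int[leb]_x (tent b x * cos (- (2 * pi * (x * y)))) =
    \int[leb]_(x in `[- b, b]) h x.
  rewrite [RHS]Rintegral_mkcond; apply: eq_Rintegral => x _.
  rewrite cosN (_ : _ * (x * y) = w * x); last by rewrite /w; ring.
  rewrite patchE; case: ifPn => // /negP.
  rewrite inE/= in_itv/= -ler_norml => /negP; rewrite -ltNge => /ltW.
  by move=> /(tent_eq0 b0) ->; rewrite mul0r.
have le1 : (BLeft (- b) <= BRight 0)%O by rewrite bnd_simp oppr_le0 ltW.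
have le2 : (BRight 0 <= BRight b)%O by rewrite bnd_simp ltW.
(* Cutting at 0 leaves the half-open interval []0, b]]; adding the null endpoint makes it closed. *)
have := Rintegral_itvB hi le1 le2; rewrite Rintegral_itv_obnd_cbnd; last first.
  by apply: integrableS hi => //; apply: subset_itv; rewrite bnd_simp// lerNl oppr0 ltW.
move/eqP; rewrite subr_eq => /eqP ->.
have -> : \int[leb]_(x in `[0, b]) h x =
    \int[leb]_(x in `[0, b]) ((1 - b^-1 * x) * cos (w * x)).
  apply: eq_Rintegral => x; rewrite inE/= in_itv/= => /andP[x0 xb].
  by rewrite /h /tent ger0_norm// max_r ?(mulrC x)// subr_ge0 mulrC ler_pdivrMr// mul1r.
have -> : \int[leb]_(x in `[- b, 0]) h x =
    \int[leb]_(x in `[- b, 0]) ((1 - (- b^-1) * x) * cos (w * x)).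
  apply: eq_Rintegral => x; rewrite inE/= in_itv/= => /andP[xb x0].
  rewrite /h /tent ler0_norm// max_r ?(mulrC (- x)) ?mulNr ?mulrN// -mulrN.
  by rewrite subr_ge0 mulrC ler_pdivrMr// mul1r lerNl.
rewrite !Rintegral_linear_cos ?oppr_lt0//.
have bn0 : b != 0 by rewrite gt_eqF.
rewrite !mulr0 sin0 cos0 mulrNN mulVf// subrr !mul0r !mulr0 mulrN cosN.
rewrite [leRHS](_ : _ = 2 / (b * w ^+ 2) * (1 - cos (w * b))); last by field; rewrite bn0 w0.
by rewrite mulr_ge0 ?subr_ge0 ?cos_le1// divr_ge0// mulr_ge0 ?sqr_ge0// ltW.
Qed.

(** The integrand is odd, so by reflection its integral equals its own opposite. *)
Lemma Rintegral_even_sin (g : R -> R) y :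
  continuous g -> leb.-integrable setT (EFin \o g) ->
  (forall x, g (- x) = g x) ->
  \int[leb]_x (g x * sin (- (2 * pi * (x * y)))) = 0.
Proof.
move=> cg ig eg; set h := fun x => _.
have ih : leb.-integrable setT (EFin \o h).
  apply: le_integrable ig => //.
    apply/measurable_EFinP; apply: continuous_measurable_fun => x.
    apply: cvgM; first exact: cg.
    apply: continuous_comp; last exact: continuous_sin.
    apply: cvgN; apply: cvgM; first exact: cvg_cst.
    by apply: cvgM; [exact: cvg_id|exact: cvg_cst].
  move=> x _; rewrite lee_fin /h normrM ler_piMr//; exact: sin_max.
have := Rintegral_opp ih.
rewrite (_ : \int[leb]_x h (- x) = - \int[leb]_x h x); first lra.
rewrite -mulN1r -RintegralZl//; apply: eq_Rintegral => x _.
by rewrite /h eg mulNr mulrN [in LHS]sinN mulrN mulN1r.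
Qed.

End fejer.

(** * Fourier transforms of tensor products *)

Section modulated_integrals.
Context d (T : measurableType d) (R : realType) (m : {measure set T -> \bar R}).
Implicit Types (f th : T -> R).

Lemma integrableM_bounded f (h : T -> R) : m.-integrable setT (EFin \o f) ->
  measurable_fun setT h -> (forall x, `|h x| <= 1) ->
  m.-integrable setT (EFin \o (fun x => f x * h x)).
Proof.
move=> fi mh h1; apply: (le_integrable _ _ _ fi) => //.
  apply/measurable_EFinP/measurable_funM => //.
  exact/measurable_EFinP/(measurable_int _ fi).
by move=> x _; rewrite lee_fin normrM ler_piMr.
Qed.

Lemma integrable_cos f th : m.-integrable setT (EFin \o f) ->
  measurable_fun setT th -> m.-integrable setT (EFin \o (fun x => f x * cos (th x))).
Proof.
move=> fi mth; apply: integrableM_bounded => // [|x]; last exact: cos_max.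
apply: (@measurableT_comp _ _ _ _ _ _ (@cos R)) => //.
by apply: continuous_measurable_fun; exact: continuous_cos.
Qed.

Lemma integrable_sin f th : m.-integrable setT (EFin \o f) ->
  measurable_fun setT th -> m.-integrable setT (EFin \o (fun x => f x * sin (th x))).
Proof.
move=> fi mth; apply: integrableM_bounded => // [|x]; last exact: sin_max.
apply: (@measurableT_comp _ _ _ _ _ _ (@sin R)) => //.
by apply: continuous_measurable_fun; exact: continuous_sin.
Qed.

End modulated_integrals.

Section tensor.
Context d1 d2 (T1 : measurableType d1) (T2 : measurableType d2) (R : realType).
Variables (m1 : {sigma_finite_measure set T1 -> \bar R})
          (m2 : {sigma_finite_measure set T2 -> \bar R}).

Section product.
Variables (f : T1 -> R) (g : T2 -> R).
Hypotheses (fi : m1.-integrable setT (EFin \o f))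
           (gi : m2.-integrable setT (EFin \o g)).

Let mf : measurable_fun setT f.
Proof. exact/measurable_EFinP/(measurable_int _ fi). Qed.

Let mg : measurable_fun setT g.
Proof. exact/measurable_EFinP/(measurable_int _ gi). Qed.

Lemma integrable_tensor :
  (m1 \x m2)%E.-integrable setT (EFin \o (fun p => f p.1 * g p.2)).
Proof.
have mfg : measurable_fun setT (fun p : T1 * T2 => f p.1 * g p.2).
  by apply: measurable_funM; exact: measurableT_comp.
apply/integrable12ltyP; first exact/measurable_EFinP.
have [_ foo] := integrableP _ _ _ fi; have [_ goo] := integrableP _ _ _ gi.
have mnf : measurable_fun setT (fun x => `|(f x)%:E|%E).
  by apply: measurableT_comp => //; exact/measurable_EFinP.
have mng : measurable_fun setT (fun x => `|(g x)%:E|%E).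
  by apply: measurableT_comp => //; exact/measurable_EFinP.
under eq_integral => x _.
  under eq_integral => y _ do rewrite /= normrM EFinM -!abse_EFin.
  rewrite ge0_integralZl//.
  over.
rewrite ge0_integralZr//; last exact: integral_ge0.
by rewrite lte_mul_pinfty// ?integral_ge0// ge0_fin_numE ?integral_ge0.
Qed.

Lemma Rintegral_tensor :
  \int[(m1 \x m2)%E]_p (f p.1 * g p.2) = (\int[m1]_x f x) * (\int[m2]_y g y).
Proof.
rewrite {1}/Rintegral -(integral12_prod_meas1 integrable_tensor) /fubini_F.
under eq_integral => x _.
  under eq_integral => y _ do rewrite /= EFinM.
  rewrite integralZl//.
  rewrite -[X in (_ * X)%E]fineK; last exact: integrable_fin_num.
  over.
rewrite integralZr// fineM//; exact: integrable_fin_num.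
Qed.

End product.

Section phases.
Variables (f : T1 -> R) (g : T2 -> R) (th1 : T1 -> R) (th2 : T2 -> R).
Hypotheses (fi : m1.-integrable setT (EFin \o f))
           (gi : m2.-integrable setT (EFin \o g))
           (mth1 : measurable_fun setT th1) (mth2 : measurable_fun setT th2)
           (sf : \int[m1]_x (f x * sin (th1 x)) = 0)
           (sg : \int[m2]_x (g x * sin (th2 x)) = 0).

(** Expanding the cosine of a sum leaves a product of cosines minus a product of sines. Fubini
    factors both, and the second has integral 0 by [sf]. *)
Lemma Rintegral_tensor_cos :
  \int[(m1 \x m2)%E]_p (f p.1 * g p.2 * cos (th1 p.1 + th2 p.2)) =
  (\int[m1]_x (f x * cos (th1 x))) * (\int[m2]_y (g y * cos (th2 y))).
Proof.
have fc := integrable_cos fi mth1; have gc := integrable_cos gi mth2.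
have fs := integrable_sin fi mth1; have gs := integrable_sin gi mth2.
have := Rintegral_tensor fs gs; rewrite sf mul0r => s0.
rewrite -(Rintegral_tensor fc gc) -[RHS]subr0 -s0.
rewrite -RintegralB//; [|exact: integrable_tensor fc gc|exact: integrable_tensor fs gs].
by apply: eq_Rintegral => p _; rewrite cosD; ring.
Qed.

Lemma Rintegral_tensor_sin :
  \int[(m1 \x m2)%E]_p (f p.1 * g p.2 * sin (th1 p.1 + th2 p.2)) = 0.
Proof.
have fc := integrable_cos fi mth1; have gc := integrable_cos gi mth2.
have fs := integrable_sin fi mth1; have gs := integrable_sin gi mth2.
have := Rintegral_tensor fs gc; rewrite sf mul0r => s0.
have := Rintegral_tensor fc gs; rewrite sg mulr0 => s1.
transitivity (0 + 0 : R); last exact: addr0.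
rewrite -[X in _ = X + _]s0 -[X in _ = _ + X]s1 -RintegralD//;
  [|exact: integrable_tensor fs gc|exact: integrable_tensor fc gs].
by apply: eq_Rintegral => p _; rewrite sinD; ring.
Qed.

End phases.
End tensor.

(** * Functions of product form on R^n and their transforms *)

Section product_functions.
Context {R : realType}.
Notation leb := (@lebesgue_measure R).
Implicit Types (n : nat) (g : R -> R).

Definition phase (t : R) : R := - (2 * pi * t).

Lemma phaseD s t : phase (s + t) = phase s + phase t.
Proof. by rewrite /phase mulrDr opprD. Qed.

Lemma measurable_dotl n (y : 'rV[R]_n) : measurable_fun setT (fun x => dot x y).
Proof.
apply: measurable_sum => i; apply: measurable_funM => //.
exact: measurable_rV_coord.
Qed.

Lemma measurable_phase d (T : measurableType d) (h : T -> R) :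
  measurable_fun setT h -> measurable_fun setT (fun x => phase (h x)).
Proof. by move=> mh; apply: measurable_funN; exact: measurable_funM. Qed.

Definition prodf g n (x : 'rV[R]_n) := \prod_(i < n) g (x ord0 i).

Lemma measurable_prodf g n : measurable_fun setT g -> measurable_fun setT (prodf g (n := n)).
Proof.
move=> mg; apply: measurable_prod => i _.
apply: (measurableT_comp (f := g)) => //; exact: measurable_rV_coord.
Qed.

Lemma prodf_cons g n a (x : 'rV[R]_n) : prodf g (cons_rV (a, x)) = g a * prodf g x.
Proof.
rewrite /prodf big_ord_recl mxE unlift_none /=; congr (_ * _).
by apply: eq_bigr => i _; rewrite mxE liftK.
Qed.

Lemma dot_cons n a (x : 'rV[R]_n) y :
  dot (cons_rV (a, x)) y = a * y ord0 ord0 + dot x (uncons_rV y).2.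
Proof.
rewrite /dot big_ord_recl mxE unlift_none /=; congr (_ + _).
by apply: eq_bigr => i _; rewrite !mxE liftK.
Qed.

(** The measure [lebesgue_rV R n.+1] is by construction the pushforward of a product measure along
    [cons_rV], so this is the change of variables for pushforwards. *)
Lemma Rintegral_cons n (h : 'rV[R]_n.+1 -> R) : measurable_fun setT h ->
  (leb \x lebesgue_rV R n)%E.-integrable setT (EFin \o h \o @cons_rV R n) ->
  (lebesgue_rV R n.+1).-integrable setT (EFin \o h) /\
  \int[lebesgue_rV R n.+1]_x h x =
  \int[(leb \x lebesgue_rV R n)%E]_p h (cons_rV p).
Proof.
move=> mh hi; split.
  apply: (integrable_pushforward (@measurable_cons_rV R n) _ hi) => //.
  exact/measurable_EFinP.
rewrite /Rintegral; congr fine.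
apply: (integral_pushforward (@measurable_cons_rV R n) _ hi) => //.
exact/measurable_EFinP.
Qed.

Section transform.
Variables (g : R -> R) (mg : measurable_fun setT g).
Hypothesis gi : leb.-integrable setT (EFin \o g).
Hypothesis gs : forall y, \int[leb]_x (g x * sin (phase (x * y))) = 0.

(** Induction on [n], splitting off the first coordinate. The three claims go together:
    integrability in dimension [n] feeds Fubini, and the vanishing sine integral feeds the next
    one. *)
Lemma prodf_transform n (y : 'rV[R]_n) :
  [/\ (lebesgue_rV R n).-integrable setT (EFin \o prodf g (n := n)),
      \int[lebesgue_rV R n]_x (prodf g x * cos (phase (dot x y))) =
        \prod_(i < n) \int[leb]_x (g x * cos (phase (x * y ord0 i))) &
      \int[lebesgue_rV R n]_x (prodf g x * sin (phase (dot x y))) = 0].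
Proof.
elim: n y => [|n IHn] y.
  have d0 (x : 'rV[R]_0) : dot x y = 0 by rewrite /dot big_ord0.
  have p0 (x : 'rV[R]_0) : prodf g x = 1 by rewrite /prodf big_ord0.
  have mp : measurable_fun setT (prodf g (n := 0)) by exact: measurable_prodf.
  split.
  - apply/integrableP; split; first exact/measurable_EFinP.
    under eq_integral do rewrite /= p0 normr1.
    by rewrite integral_dirac//= diracT mul1e ltry.
  - under eq_Rintegral do rewrite d0 p0 /phase mulr0 oppr0 cos0 mulr1.
    by rewrite big_ord0 Rintegral_cst// mul1r /= indicE mem_set.
  - under eq_Rintegral do rewrite d0 p0 /phase mulr0 oppr0 sin0 mulr0.
    by rewrite Rintegral_cst// mul0r.
have [ii ic sn0] := IHn (uncons_rV y).2.
have mth0 : measurable_fun setT (fun a : measurableTypeR R => phase (a * y ord0 ord0)).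
  by apply: measurable_phase; exact: measurable_funM.
have mth : measurable_fun setT (fun x : 'rV[R]_n => phase (dot x (uncons_rV y).2)).
  by apply: measurable_phase; exact: measurable_dotl.
have mp : measurable_fun setT (prodf g (n := n.+1)) by exact: measurable_prodf.
have my : measurable_fun setT (fun x : 'rV[R]_n.+1 => phase (dot x y)).
  by apply: measurable_phase; exact: measurable_dotl.
have it := integrable_tensor gi ii.
have [pint _] : (lebesgue_rV R n.+1).-integrable setT (EFin \o prodf g (n := n.+1)) /\
    \int[lebesgue_rV R n.+1]_x prodf g x =
    \int[(leb \x lebesgue_rV R n)%E]_p prodf g (cons_rV p).
  apply: Rintegral_cons => //; apply: eq_integrable it => // -[a x] _ /=.
  by rewrite prodf_cons.
have E a x : phase (dot (cons_rV (a, x)) y) =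
    phase (a * y ord0 ord0) + phase (dot x (uncons_rV y).2).
  by rewrite dot_cons phaseD.
have m12 : measurable_fun setT (fun p : measurableTypeR R * 'rV[R]_n =>
    phase (p.1 * y ord0 ord0) + phase (dot p.2 (uncons_rV y).2)).
  apply: measurable_funD; first exact: (measurableT_comp mth0 measurable_fst).
  exact: (measurableT_comp mth measurable_snd).
split=> //.
- rewrite (Rintegral_cons _ _).2; last 2 first.
  + apply: measurable_funM => //; apply: (measurableT_comp (f := cos)) => //.
    by apply: continuous_measurable_fun; exact: continuous_cos.
  + apply: eq_integrable (integrable_cos it m12) => // -[a x] _ /=.
    by rewrite prodf_cons E.
  rewrite big_ord_recl.
  under [X in _ = _ * X]eq_bigr => i _.
    rewrite (_ : y ord0 (lift ord0 i) = (uncons_rV y).2 ord0 i); last by rewrite mxE.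
    over.
  rewrite -ic -(Rintegral_tensor_cos gi ii mth0 mth)//.
  by apply: eq_Rintegral => -[a x] _; rewrite prodf_cons E.
- rewrite (Rintegral_cons _ _).2; last 2 first.
  + apply: measurable_funM => //; apply: (measurableT_comp (f := sin)) => //.
    by apply: continuous_measurable_fun; exact: continuous_sin.
  + apply: eq_integrable (integrable_sin it m12) => // -[a x] _ /=.
    by rewrite prodf_cons E.
  rewrite -(Rintegral_tensor_sin gi ii mth0 mth)//.
  by apply: eq_Rintegral => -[a x] _; rewrite prodf_cons E.
Qed.

End transform.
End product_functions.

(** * Real and imaginary parts of the Fourier transform *)

Section cosine_transform.
Context d (T : measurableType d) (R : realType).
Variables (m : {measure set T -> \bar R}) (ip : T -> T -> R).
Implicit Types (f g : T -> R) (y : T).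

Definition cosT f y := \int[m]_x (f x * cos (phase (ip x y))).
Definition sinT f y := \int[m]_x (f x * sin (phase (ip x y))).

Lemma fourierE f y : fourier m ip f y = (cosT f y +i* sinT f y)%C.
Proof.
rewrite /fourier /Cintegral; congr (_ +i* _)%C; apply: eq_Rintegral => x _ /=.
  by rewrite mul0r subr0.
by rewrite mul0r addr0.
Qed.

(** In the order of [R[i]], a number is nonnegative when its imaginary part is 0 and its real part
    is nonnegative. All further work is with real integrals. *)
Lemma fourier_ge0P f y : 0 <= fourier m ip f y <-> sinT f y = 0 /\ 0 <= cosT f y.
Proof.
by rewrite fourierE lecE /=; split=> [/andP[/eqP]|[-> ->]]; rewrite ?eqxx.
Qed.

Lemma fourier_eq1 f y : fourier m ip f y = 1 <-> sinT f y = 0 /\ cosT f y = 1.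
Proof.
by rewrite fourierE; split=> [[-> ->]|[-> ->]].
Qed.

End cosine_transform.

(** * Products of tents and of Fejer kernels; continuity of a transform at the origin *)

Section product_kernels.
Context {R : realType} {n : nat}.
Notation leb := (@lebesgue_measure R).
Notation lebn := (lebesgue_rV R n).
Implicit Types (f : 'rV[R]_n -> R) (b : R).

Lemma continuous_prodf (g : R -> R) : continuous g -> continuous (prodf g (n := n)).
Proof.
move=> cg; apply: continuous_big => [|i _ x]; first exact: mul_continuous.
by apply: continuous_comp; [exact: coord_continuous|exact: cg].
Qed.

Lemma prodf_ge0 (g : R -> R) (x : 'rV[R]_n) : (forall t, 0 <= g t) -> 0 <= prodf g x.
Proof. by move=> g0; exact: prodr_ge0. Qed.

Let tent_transform b (b0 : 0 < b) (y : 'rV[R]_n) :=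
  prodf_transform (continuous_measurable_fun (@continuous_tent R b)) (integrable_tent b0)
    (fun y => Rintegral_even_sin y (@continuous_tent R b) (integrable_tent b0) (tentN b)) y.

Let fejer_transform b (y : 'rV[R]_n) :=
  prodf_transform (continuous_measurable_fun (@continuous_fejer R b)) (integrable_fejer b)
    (fun y => Rintegral_even_sin y (@continuous_fejer R b) (integrable_fejer b) (fejerN b)) y.

Lemma integrable_prod_tent b : 0 < b -> lebn.-integrable setT (EFin \o prodf (tent b) (n := n)).
Proof. by move=> b0; have [] := tent_transform b0 0. Qed.

Lemma sinT_prod_tent b y : 0 < b -> sinT lebn (@dot R n) (prodf (tent b) (n := n)) y = 0.
Proof. by move=> b0; have [] := tent_transform b0 y. Qed.

Lemma cosT_prod_tent_ge0 b y : 0 < b -> 0 <= cosT lebn (@dot R n) (prodf (tent b) (n := n)) y.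
Proof.
move=> b0; have [_ h _] := tent_transform b0 y; rewrite /cosT h.
by apply: prodr_ge0 => i _; exact: Rintegral_tent_cos_ge0.
Qed.

Lemma integrable_prod_fejer b : lebn.-integrable setT (EFin \o prodf (fejer b) (n := n)).
Proof. by have [] := fejer_transform b 0. Qed.

Lemma sinT_prod_fejer b y : sinT lebn (@dot R n) (prodf (fejer b) (n := n)) y = 0.
Proof. by have [] := fejer_transform b y. Qed.

Lemma cosT_prod_fejer b y : 0 < b ->
  cosT lebn (@dot R n) (prodf (fejer b) (n := n)) y = prodf (tent b) y.
Proof.
move=> b0; have [_ h _] := fejer_transform b y; rewrite /cosT h.
by apply: eq_bigr => i _; exact: Rintegral_fejer_cos.
Qed.

Lemma prod_tent_eq0 b (y : 'rV[R]_n) i : 0 < b -> b <= `|y ord0 i| -> prodf (tent b) y = 0.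
Proof. by move=> b0 yb; rewrite /prodf (bigD1 i)//= tent_eq0// mul0r. Qed.

Lemma prod_tent_le1 b (y : 'rV[R]_n) : 0 < b -> prodf (tent b) y <= 1.
Proof. by move=> b0; apply: prodr_ile1 => i _; rewrite tent_ge0 tent_le1. Qed.

Lemma prod_tent0 b : prodf (tent b) (0 : 'rV[R]_n) = 1.
Proof. by rewrite /prodf big1// => i _; rewrite mxE tent0. Qed.

Lemma dotC (x y : 'rV[R]_n) : dot x y = dot y x.
Proof. by apply: eq_bigr => i _; rewrite mulrC. Qed.

Lemma dot0r (x : 'rV[R]_n) : dot x 0 = 0.
Proof. by rewrite /dot big1// => i _; rewrite mxE mulr0. Qed.

Lemma cosT_at0 f : cosT lebn (@dot R n) f 0 = \int[lebn]_x f x.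
Proof.
by apply: eq_Rintegral => x _; rewrite dot0r /phase mulr0 oppr0 cos0 mulr1.
Qed.

Lemma Rintegral_prod_tent_gt0 b : 0 < b -> 0 < \int[lebn]_x prodf (tent b) x.
Proof.
move=> b0; have [_ h _] := tent_transform b0 0.
rewrite -cosT_at0 /cosT h; apply: prodr_gt0 => i _.
under eq_Rintegral do rewrite mxE mulr0 /phase mulr0 oppr0 cos0 mulr1.
apply: Rintegral_continuous_gt0; [exact: continuous_tent|exact: tent_ge0| |].
  exact: integrable_tent.
by rewrite tent0.
Qed.

(** Otherwise some sequence of frequencies tends to 0 while the transform stays at least [e] below
    its value at 0. Dominated convergence with majorant [|f|] forbids this. The lemma supplies the
    cube in which the transform of [w] must be supported. *)
Lemma cosT_gt_near0 f e : lebn.-integrable setT (EFin \o f) -> 0 < e ->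
  exists2 b : R, 0 < b & forall y : 'rV[R]_n, (forall i, `|y ord0 i| < b) ->
    cosT lebn (@dot R n) f 0 - e < cosT lebn (@dot R n) f y.
Proof.
move=> fi e0; apply: contrapT => H.
(* Failure for [b = 1/(k+1)] yields the [k]-th term of the sequence. *)
have {}H k : exists y : 'rV[R]_n, (forall i, `|y ord0 i| < k.+1%:R^-1) /\
    cosT lebn (@dot R n) f y <= cosT lebn (@dot R n) f 0 - e.
  apply: contrapT => Hk; apply: H; exists k.+1%:R^-1; first by rewrite invr_gt0.
  by move=> y yk; rewrite ltNge; apply/negP => le; apply: Hk; exists y.
have [u Hu] := choice H.
have mph y : measurable_fun setT (fun x : 'rV[R]_n => phase (dot x y)).
  by apply: measurable_phase; exact: measurable_dotl.
have ii y := integrable_cos fi (mph y).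
have cu : (\int[lebn]_x (f x * cos (phase (dot x (u k))))%:E)%E @[k --> \oo] -->
    (\int[lebn]_x (f x * cos (phase (dot x 0)))%:E)%E.
  apply: (@dominated_cvg _ _ _ lebn setT measurableT _ _ (fun x => `|f x|%:E)) => //.
  - by move=> k; exact: measurable_int (ii (u k)).
  - move=> x _; apply: cvg_EFin; first exact: nearW.
    apply: cvgM; first exact: cvg_cst.
    apply: (cvg_comp (fun k => phase (dot x (u k))) cos); last exact: continuous_cos.
    apply: cvgN; apply: cvgM; first exact: cvg_cst.
    apply: (@cvg_big _ _ +%R); first exact: add_continuous.
    move=> i _; apply: cvgM; first exact: cvg_cst.
    rewrite mxE; apply/cvgrPdist_lt => eps eps0.
    near=> k; rewrite sub0r normrN.
    apply: (lt_trans ((Hu k).1 i)); near: k.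
    exact: near_infty_natSinv_lt (PosNum eps0).
  - exact: integrable_norm.
  - by move=> k x _; rewrite lee_fin normrM ler_piMr// cos_max.
have /fine_cvgP[_] :
    (\int[lebn]_x (f x * cos (phase (dot x (u k))))%:E)%E @[k --> \oo] -->
    (cosT lebn (@dot R n) f 0)%:E.
  by rewrite /cosT /Rintegral fineK//; exact: (integrable_fin_num measurableT (ii 0)).
move=> /cvgrPdist_lt /(_ _ e0)[k _ /(_ k (leqnn k))] /=.
have := (Hu k).2; rewrite /cosT /Rintegral.
set a := fine _; set c := fine _; rewrite ltr_norml => ? /andP[? ?]; lra.
Unshelve. all: by end_near. Qed.

End product_kernels.

(** * Nonnegativity at the origin, and the Euclidean norm against coordinates *)

Section bounds.
Context {R : realType} {n : nat}.
Notation leb := (@lebesgue_measure R).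
Notation lebn := (lebesgue_rV R n).
Implicit Types (f : 'rV[R]_n -> R) (b : R).

Lemma measurable_dot_pair :
  measurable_fun setT (fun p : 'rV[R]_n * 'rV[R]_n => dot p.1 p.2).
Proof.
apply: measurable_sum => i; apply: measurable_funM.
  exact: (measurableT_comp (measurable_rV_coord i) measurable_fst).
exact: (measurableT_comp (measurable_rV_coord i) measurable_snd).
Qed.

(* Fubini turns [\int f * hat k] into [\int hat f * k], here with [k] the Fejer kernel. *)
Lemma Rintegral_mul_prod_tent f b : lebn.-integrable setT (EFin \o f) -> 0 < b ->
  \int[lebn]_x (f x * prodf (tent b) x) =
  \int[lebn]_y (prodf (fejer b) y * cosT lebn (@dot R n) f y).
Proof.
move=> fi b0; have ki := @integrable_prod_fejer R n b.
have hi := integrable_cos (integrable_tensor fi ki) (measurable_phase measurable_dot_pair).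
have := Fubini hi => /= E; congr fine.
transitivity (\int[lebn]_x \int[lebn]_y
    (f x * prodf (fejer b) y * cos (phase (dot x y)))%:E)%E.
  apply: eq_integral => x _; rewrite -cosT_prod_fejer//.
  have mx : measurable_fun setT (fun y : 'rV[R]_n => phase (dot y x)).
    by apply: measurable_phase; exact: measurable_dotl.
  have ix := integrable_cos ki mx.
  rewrite EFinM /cosT /Rintegral fineK ?integrable_fin_num// -integralZl//.
  by apply: eq_integral => y _; rewrite -EFinM mulrA dotC.
rewrite E; apply: eq_integral => y _.
have my : measurable_fun setT (fun x : 'rV[R]_n => phase (dot x y)).
  by apply: measurable_phase; exact: measurable_dotl.
have iy := integrable_cos fi my.
rewrite EFinM /cosT /Rintegral fineK ?integrable_fin_num// -integralZl//.
by apply: eq_integral => x _; rewrite -EFinM mulrA (mulrC (f x)).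
Qed.

(** If [f 0 < 0], then [f <= f 0 / 2] on a small cube, and the integral of [f] against a product of
    tents supported there is negative. By [Rintegral_mul_prod_tent] the same integral pairs a Fejer
    kernel with the nonnegative transform of [f], so it is nonnegative. This replaces Fourier
    inversion. *)
Lemma posdef_ge0 f : continuous f -> lebn.-integrable setT (EFin \o f) ->
  (forall y, 0 <= cosT lebn (@dot R n) f y) -> 0 <= f 0.
Proof.
move=> cf fi f0; rewrite leNgt; apply/negP => fn.
have e0 : 0 < - f 0 / 2 by rewrite divr_gt0// oppr_gt0.
have /cvgrPdist_lt /(_ _ e0) /nbhs_ballP[b /= b0 H] := cf 0.
have ti := @integrable_prod_tent R n b b0.
have fK : forall x : 'rV[R]_n, f x * prodf (tent b) x <= f 0 / 2 * prodf (tent b) x.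
  move=> x; have [i|xb] := pselect (exists i, b <= `|x ord0 i|).
    by have [j jb] := i; rewrite (prod_tent_eq0 b0 jb) !mulr0.
  apply: ler_wpM2r; first by apply: prodf_ge0 => t; exact: tent_ge0.
  (* Balls of ['rV[R]_n] are cubes for the sup norm, so the ball of radius [b] is where the product
     of tents can be nonzero. *)
  have /H : ball (0 : 'rV[R]_n) b x.
    split=> // i j; rewrite (ord1 i) mxE /ball /= sub0r normrN ltNge.
    by apply/negP => jb; apply: xb; exists j.
  by rewrite ltr_distl => /andP[]; lra.
have fKi : lebn.-integrable setT (EFin \o (fun x => f x * prodf (tent b) x)).
  apply: integrableM_bounded => //.
    by apply/measurable_EFinP; exact: measurable_int ti.
  move=> x; rewrite ger0_norm ?prod_tent_le1//.
  by apply: prodf_ge0 => t; exact: tent_ge0.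
have : 0 <= \int[lebn]_x (f x * prodf (tent b) x).
  rewrite Rintegral_mul_prod_tent//; apply: Rintegral_ge0 => y _.
  rewrite mulr_ge0//; apply: prodf_ge0 => t; exact: fejer_ge0.
have : \int[lebn]_x (f x * prodf (tent b) x) <= \int[lebn]_x (f 0 / 2 * prodf (tent b) x).
  by apply: le_Rintegral => //; exact: integrableZl ti.
rewrite RintegralZl//.
have := @Rintegral_prod_tent_gt0 R n b b0.
by move=> ? ? ?; nra.
Qed.

Lemma enorm_eq0 (x : 'rV[R]_n) : enorm x = 0 -> x = 0.
Proof.
move=> /eqP; rewrite sqrtr_eq0 => x0.
have /eqP : dot x x = 0.
  by apply/eqP; rewrite eq_le x0 sumr_ge0// => i _; rewrite -expr2 sqr_ge0.
rewrite psumr_eq0 => [/allP H|i _]; last by rewrite -expr2 sqr_ge0.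
apply/rowP => i; rewrite mxE; apply/eqP.
by have := H i (mem_index_enum _); rewrite mulf_eq0 orbb.
Qed.

(** If all coordinates were smaller, then [|x|^2 <= n r^2 / (n+1)^2 < r^2]. The denominator [n.+1]
    avoids a square root and is nonzero for every [n]. Hence a product of tents of half-width
    [r / n.+1] vanishes where [|x| >= r]. *)
Lemma enorm_ge_coord (x : 'rV[R]_n) r : 0 < r -> r <= enorm x ->
  exists i, r / n.+1%:R <= `|x ord0 i|.
Proof.
move=> r0 rx; apply: contrapT => H.
have n0 : 0 < n.+1%:R :> R by [].
have xi i : `|x ord0 i| < r / n.+1%:R.
  by rewrite ltNge; apply/negP => h; apply: H; exists i.
move: rx; apply/negP; rewrite -ltNge -(ger0_norm (ltW r0)) -sqrtr_sqr ltr_sqrt ?exprn_gt0//.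
have : dot x x <= \sum_(i < n) (r / n.+1%:R) ^+ 2.
  apply: ler_sum => i _; rewrite -expr2 -real_normK ?num_real//.
  by rewrite lerXn2r// ?nnegrE// ltW// (le_lt_trans _ (xi i)).
rewrite sumr_const card_ord => /le_lt_trans; apply.
rewrite expr_div_n -[ltLHS]mulr_natl mulrA ltr_pdivrMr ?exprn_gt0// mulrC.
rewrite ltr_pM2l ?exprn_gt0// -natrX ltr_nat; lia.
Qed.

End bounds.

(** * The lattice test function *)

Definition lat_test (R : realType) (n : nat) (f0 D : R) (f w k : 'rV[R]_n -> R)
    (p : 'rV[R]_n * 'rV[R]_n) : R :=
  f0 / D * ((f p.1 - w p.1) * k p.2) + D^-1 * (w p.1 * f p.2).

Section lat_test.
Context {R : realType} {n : nat}.
Notation lebn := (lebesgue_rV R n).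
Notation C1 := (cosT lebn (@dot R n)).
Notation S1 := (sinT lebn (@dot R n)).
Notation C2 := (cosT (lebesgue_rV2 R n) (@dot2 R n)).
Notation S2 := (sinT (lebesgue_rV2 R n) (@dot2 R n)).
Variables (f0 D : R) (f w k : 'rV[R]_n -> R).
Hypotheses (fi : lebn.-integrable setT (EFin \o f))
           (wi : lebn.-integrable setT (EFin \o w))
           (ki : lebn.-integrable setT (EFin \o k)).
Notation F := (lat_test f0 D f w k).

Let fwi : lebn.-integrable setT (EFin \o (fun x => f x - w x)).
Proof. exact: integrableB fi wi. Qed.

Let i1 := integrable_tensor fwi ki.
Let i2 := integrable_tensor wi fi.

Lemma integrable_lat_test : (lebesgue_rV2 R n).-integrable setT (EFin \o F).
Proof.
exact: (integrableD measurableT (integrableZl measurableT (f0 / D) i1)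
  (integrableZl measurableT D^-1 i2)).
Qed.

Lemma continuous_lat_test : continuous f -> continuous w -> continuous k -> continuous F.
Proof.
move=> cf cw ck p.
have c1 (h : 'rV[R]_n -> R) : continuous h -> {for p, continuous (h \o fst)}.
  by move=> ch; apply: continuous_comp; [exact: cvg_fst|exact: ch].
have c2 (h : 'rV[R]_n -> R) : continuous h -> {for p, continuous (h \o snd)}.
  by move=> ch; apply: continuous_comp; [exact: cvg_snd|exact: ch].
apply: cvgD.
  apply: cvgM; first exact: cvg_cst.
  by apply: cvgM; [apply: cvgB; exact: c1|exact: c2].
apply: cvgM; first exact: cvg_cst.
by apply: cvgM; [exact: c1|exact: c2].
Qed.

Section frequency.
Variable q : 'rV[R]_n * 'rV[R]_n.
Hypotheses (sf1 : S1 f q.1 = 0) (sf2 : S1 f q.2 = 0) (sw : S1 w q.1 = 0)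
  (sk : S1 k q.2 = 0).

Let mth (y : 'rV[R]_n) : measurable_fun setT (fun x : 'rV[R]_n => phase (dot x y)).
Proof. by apply: measurable_phase; exact: measurable_dotl. Qed.

Let cfw : C1 (fun x => f x - w x) q.1 = C1 f q.1 - C1 w q.1.
Proof.
rewrite /cosT -RintegralB//; try exact: integrable_cos.
by apply: eq_Rintegral => x _; rewrite mulrBl.
Qed.

Let sfw : S1 (fun x => f x - w x) q.1 = 0.
Proof.
transitivity (S1 f q.1 - S1 w q.1); last by rewrite sf1 sw subr0.
rewrite /sinT -RintegralB//; try exact: integrable_sin.
by apply: eq_Rintegral => x _; rewrite mulrBl.
Qed.

Let m2 : measurable_fun setT
  (fun p : 'rV[R]_n * 'rV[R]_n => phase (dot p.1 q.1) + phase (dot p.2 q.2)).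
Proof.
apply: measurable_funD; first exact: (measurableT_comp (mth q.1) measurable_fst).
exact: (measurableT_comp (mth q.2) measurable_snd).
Qed.

(** Both summands of the test function are tensor products, whose cosine transforms factor because
    the sine transforms of their first factors vanish. The scale [D] stays free here, so that it can
    later be chosen from this formula. *)
Lemma cosT_lat_test : C2 F q =
  f0 / D * ((C1 f q.1 - C1 w q.1) * C1 k q.2) + D^-1 * (C1 w q.1 * C1 f q.2).
Proof.
have E1 := Rintegral_tensor_cos fwi ki (mth q.1) (mth q.2) sfw.
have E2 := Rintegral_tensor_cos wi fi (mth q.1) (mth q.2) sw.
rewrite -cfw -E1 -E2.
have j1 := integrable_cos i1 m2; have j2 := integrable_cos i2 m2.
rewrite -RintegralZl// -[X in _ + X]RintegralZl// -RintegralD//; first last.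
- exact: integrableZl j2.
- exact: integrableZl j1.
by apply: eq_Rintegral => p _; rewrite /dot2 phaseD /lat_test; ring.
Qed.

Lemma sinT_lat_test : S2 F q = 0.
Proof.
have E1 := Rintegral_tensor_sin fwi ki (mth q.1) (mth q.2) sfw sk.
have E2 := Rintegral_tensor_sin wi fi (mth q.1) (mth q.2) sw sf2.
have j1 := integrable_sin i1 m2; have j2 := integrable_sin i2 m2.
transitivity (f0 / D * 0 + D^-1 * 0); last by rewrite !mulr0 addr0.
rewrite -[in X in X + _]E1 -[in X in _ + X]E2.
rewrite -RintegralZl// -[X in _ + X]RintegralZl// -RintegralD//; first last.
- exact: integrableZl j2.
- exact: integrableZl j1.
by apply: eq_Rintegral => p _; rewrite /dot2 phaseD /lat_test; ring.
Qed.

End frequency.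
End lat_test.

(** * Feasibility of the test function and comparison of the two bounds *)

Lemma LPlat_feasible_of_LP2 (R : realType) (n : nat) (r c : R)
    (f : 'rV[R]_n -> R) : 0 < r -> 0 < c < 1 -> LP2_feasible r f -> 0 <= f 0 ->
  exists2 D, c <= D & exists2 F, LPlat_feasible (n := n) r F & F (0, 0) = f 0 ^+ 2 / D.
Proof.
move=> r0 /andP[c0 c1] [cf fi fhat0 fhat1 fneg] f00.
pose C1 := cosT (lebesgue_rV R n) (@dot R n).
pose S1 := sinT (lebesgue_rV R n) (@dot R n).
have sf y : S1 f y = 0 by have [] := (fourier_ge0P _ _ _ _).1 (fhat0 y).
have Cf y : 0 <= C1 f y by have [] := (fourier_ge0P _ _ _ _).1 (fhat0 y).
have [_ Cf0] := (fourier_eq1 _ _ _ _).1 fhat1.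
(* The margin [1 - c] gives a cube on which the transform of [f] exceeds [1 - (1 - c) = c]. *)
have [|b b0 Hb] := @cosT_gt_near0 R n f (1 - c) fi; first by rewrite subr_gt0.
have {}Cf0 : C1 f 0 = 1 by exact: Cf0.
rewrite -/C1 Cf0 in Hb.
(* With this width, [enorm_ge_coord] makes [k] vanish on [|y| >= r]. *)
pose a := r / n.+1%:R; have a0 : 0 < a by rewrite divr_gt0.
pose k := prodf (tent a) (n := n).
pose K := prodf (fejer b) (n := n).
pose w (x : 'rV[R]_n) := c * K x.
have Ki := @integrable_prod_fejer R n b.
have wi : (lebesgue_rV R n).-integrable setT (EFin \o w) by exact: integrableZl Ki.
have ki := @integrable_prod_tent R n a a0.
have mth (y : 'rV[R]_n) : measurable_fun setT (fun x : 'rV[R]_n => phase (dot x y)).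
  by apply: measurable_phase; exact: measurable_dotl.
have Cw y : C1 w y = c * prodf (tent b) y.
  rewrite -cosT_prod_fejer// /C1 /cosT -RintegralZl//; last exact: integrable_cos.
  by apply: eq_Rintegral => x _; rewrite /w mulrA.
have sw y : S1 w y = 0.
  rewrite -(mulr0 c) -(sinT_prod_fejer b y) /S1 /sinT -RintegralZl//;
    last exact: integrable_sin.
  by apply: eq_Rintegral => x _; rewrite /w mulrA.
have sk y : S1 k y = 0 by exact: sinT_prod_tent.
have Ck y : 0 <= C1 k y by exact: cosT_prod_tent_ge0.
have k0 : k 0 = 1 by exact: prod_tent0.
have w0 x : 0 <= w x.
  by rewrite mulr_ge0 ?(ltW c0)// prodf_ge0// => t; exact: fejer_ge0.
have Cw0 y : 0 <= C1 w y.
  by rewrite Cw mulr_ge0 ?(ltW c0)// prodf_ge0// => t; exact: tent_ge0.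
have Cwf y : C1 w y <= C1 f y.
  (* Outside the cube of half-width [b] the transform of [w] is 0; inside it is at most [c], which
     the transform of [f] exceeds. *)
  have [[i yi]|yb] := pselect (exists i, b <= `|y ord0 i|).
    by rewrite Cw (prod_tent_eq0 b0 yi) mulr0.
  apply: (@le_trans _ _ c); first by rewrite Cw ler_piMr ?(ltW c0)// prod_tent_le1.
  have := Hb y; rewrite subKr => /(_ _)/ltW; apply=> i.
  by rewrite ltNge; apply/negP => yi; apply: yb; exists i.
(* [D] is the transform at the origin of the unnormalised test function, where [f] contributes 1 and
   [w] contributes [c]. *)
pose D := f 0 * ((1 - c) * C1 k 0) + c.
have cD : c <= D by rewrite lerDr !mulr_ge0// subr_ge0 ltW.
have D0 : 0 < D by exact: lt_le_trans cD.
exists D => //; exists (lat_test (f 0) D f w k); last first.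
  by rewrite /lat_test /= k0 mulr1; field; rewrite gt_eqF.
have Dge0 : 0 <= D^-1 by rewrite invr_ge0 ltW.
split.
- apply: continuous_lat_test => //.
    move=> x; apply: (@cvgM _ _ (nbhs x) _ (cst c) K); first exact: cvg_cst.
    by apply: continuous_prodf; exact: continuous_fejer.
  by apply: continuous_prodf; exact: continuous_tent.
- exact: integrable_lat_test.
- move=> q; apply/fourier_ge0P; split; first exact: sinT_lat_test.
  rewrite cosT_lat_test// addr_ge0 ?mulr_ge0// ?subr_ge0//; exact: Cwf.
- apply/fourier_eq1; split; first exact: sinT_lat_test.
  rewrite cosT_lat_test//.
  rewrite -[LHS]/(f 0 / D * ((C1 f 0 - C1 w 0) * C1 k 0) + D^-1 * (C1 w 0 * C1 f 0)).
  rewrite Cf0 Cw prod_tent0 !mulr1 mulrAC [D^-1 * _]mulrC -mulrDl.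
  by rewrite divff// gt_eqF.
move=> x y xy okx oky _ _; rewrite /lat_test /=.
(* If [y = 0], then [x] is nonzero, so [|x| >= r], and the terms in [w] cancel to leave
   [f 0 / D * f x]. If [|y| >= r], then [k y = 0] and only [w x * f y / D] remains. *)
have [/enorm_eq0 y0|ry] := oky.
  have {}okx : r <= enorm x by case: okx => // /enorm_eq0 x0; rewrite x0 y0 in xy.
  rewrite y0 k0 mulr1.
  rewrite [leLHS](_ : _ = f 0 / D * f x); last by ring.
  by rewrite mulr_ge0_le0 ?divr_ge0 ?(ltW D0)// fneg.
have [i yi] := enorm_ge_coord r0 ry.
rewrite /k (prod_tent_eq0 a0 yi) !mulr0 add0r.
by rewrite mulr_ge0_le0// mulr_ge0_le0// fneg.
Qed.

Lemma LP2_feasible_ge0 (R : realType) (n : nat) (r : R) (f : 'rV[R]_n -> R) :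
  LP2_feasible r f -> 0 <= f 0.
Proof.
move=> [cf fi fhat0 _ _]; apply: posdef_ge0 => // y.
by have [] := (fourier_ge0P _ _ _ _).1 (fhat0 y).
Qed.

Theorem theorem4p2 (R : realType) (n : nat) (hn : (1 <= n)%N) (r : R)
    (hr : 0 < r) :
  (Delta_lat n r <= Delta2 n r)%E.
Proof.
have v0 : (0 <= ball_vol n (r / 2))%E by exact: measure_ge0.
apply/ereal_infP => _ [f ff <-].
have f0 := LP2_feasible_ge0 ff.
(* This is the passage to the limit [c -> 1]: as [Delta_lat] is nonnegative, it suffices to bound
   [c * Delta_lat] for every [c] in []0, 1[]. *)
apply/lee_mul01Pr => [|c c01].
  by apply/ereal_infP => _ [F _ <-]; rewrite mule_ge0// lee_fin sqrtr_ge0.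
have [D cD [F FF F0]] := LPlat_feasible_of_LP2 hr c01 ff f0.
have [c0 c1] := andP c01.
have D0 : 0 < D by exact: lt_le_trans cD.
have le1 : (Delta_lat n r <= ball_vol n (r / 2) * (Num.sqrt (F (0, 0)))%:E)%E.
  apply: ge_ereal_inf.
  by exists (ball_vol n (r / 2) * (Num.sqrt (F (0, 0)))%:E)%E => //; exists F.
apply: (le_trans (lee_wpmul2l _ le1)); first by rewrite lee_fin ltW.
rewrite muleCA -EFinM lee_wpmul2l// lee_fin F0.
rewrite sqrtrM ?sqr_ge0// sqrtr_sqr ger0_norm// mulrCA ler_piMr//.
rewrite sqrtrV ?(ltW D0)// ler_pdivrMr ?sqrtr_gt0// mul1r.
(* What remains is [c <= sqrt D], obtained from [c <= sqrt c] as [c < 1], and [sqrt c <= sqrt D] as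
   [c <= D]. *)
apply: (@le_trans _ _ (Num.sqrt c)); last exact: ler_wsqrtr.
rewrite -{1}(sqr_sqrtr (ltW c0)) expr2 ler_piMr ?sqrtr_ge0//.
by rewrite -[leRHS]sqrtr1 ler_wsqrtr// ltW.
Qed.
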